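(* Let $C_1,\ldots,C_m\subseteq\mathcal{E}$ be closed convex sets with $C:=\bigcap_{i=1}^m C_i\neq\emptyset$. (i) $C_1,\ldots,C_m$ satisfy a H\''olderian error bound if and only if there are a monotone nonincreasing function $\gamma:[0,\infty)\to(0,1]$ and a monotone nondecreasing function $\rho:[0,\infty)\to(0,\infty)$ such that $$\Phi(a,b):=\rho(b)\max\big(a^{\gamma(b)},a\big)$$ is a strict consistent error bound function for $C_1,\ldots,C_m$. (ii) $C_1,\ldots,C_m$ satisfy a uniform H\''olderian error bound with exponent $\gamma\in(0,1]$ if and only if there exists a monotone nondecreasing function $\rho:[0,\infty)\to(0,\infty)$ such that $$\Phi(a,b):=\rho(b)a^{\gamma}$$ is a strict consistent error bound function for $C_1,\ldots,C_m$.
   Context: $\mathcal{E}$ is a finite-dimensional real vector space with norm $\|\cdot\|$ induced by an inner product, and $\mathrm{dist}(x,D)=\min_{y\in D}\|x-y\|$ for a nonempty closed convex set $D$. ''Monotone increasing'' means strictly increasing. A function $\Phi:[0,\infty)\times[0,\infty)\to[0,\infty)$ is a consistent error bound function for $C_1,\ldots,C_m$ if: (i) $\mathrm{dist}(x,C)\le\Phi\big(\max_{1\le i\le m}\mathrm{dist}(x,C_i),\|x\|\big)$ for all $x\in\mathcal{E}$; (ii) for every fixed $b\ge 0$, $\Phi(\cdot,b)$ is monotone nondecreasing on $[0,\infty)$, right-continuous at $0$, and $\Phi(0,b)=0$; (iii) for every fixed $a\ge0$, $\Phi(a,\cdot)$ is monotone nondecreasing on $[0,\infty)$. It is strict if in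 addition $\Phi(\cdot,b)$ is monotone increasing on $[0,\infty)$ for every $b>0$. $C_1,\ldots,C_m$ satisfy a H\''olderian error bound if for every bounded set $B\subseteq\mathcal{E}$ there exist $\theta_B>0$ and an exponent $\gamma_B\in(0,1]$ such that $\mathrm{dist}(x,C)\le\theta_B\max_{1\le i\le m}\mathrm{dist}(x,C_i)^{\gamma_B}$ for all $x\in B$. If the same exponent $\gamma_B=\gamma\in(0,1]$ can be taken for all $B$, the bound is uniform (with exponent $\gamma$). *)

(* Defs.v *)
From HB Require Import structures.
From mathcomp Require Import all_boot all_order all_algebra.
From mathcomp Require Import all_classical all_reals all_analysis.

Set Implicit Arguments.
Unset Strict Implicit.
Unset Printing Implicit Defensive.

Import Order.TTheory GRing.Theory Num.Theory.
Import numFieldNormedType.Exports.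

Local Open Scope classical_set_scope.
Local Open Scope ring_scope.

(* Finite-dimensional normed spaces: Vector supplies the finite dimension. *)
#[short(type="normedVectType")]
HB.structure Definition NormedVector (K : numFieldType) :=
  {E of NormedModule K E & Vector K E}.

Section ErrorBounds.
Context {R : realType} {E : normedModType R} {m : nat}.

(* The infimum over y in D of |x - y| is a minimum when D is nonempty, closed
   and convex; inf takes the junk value 0 when D is empty. *)
Definition dist (x : E) (D : set E) : R := inf [set `|x - y| | y in D].

(* All distances are nonnegative, so 0 is a neutral initial value of the max
   as soon as there is at least one set. *)
Definition max_dist (C : 'I_m -> set E) (x : E) : R :=
  \big[Num.max/0]_(i < m) dist x (C i).

(* Functions on [0, +oo[ are represented by functions on R, of which only the
   values at nonnegative arguments are constrained. *)
Definition consistent_error_bound_function (C : 'I_m -> set E)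
    (Phi : R -> R -> R) : Prop :=
  [/\ forall a b, 0 <= a -> 0 <= b -> 0 <= Phi a b,
      forall x : E, dist x (\bigcap_i C i) <= Phi (max_dist C x) `|x|,
      forall b, 0 <= b ->
        [/\ {in `[0, +oo[ &, {homo Phi ^~ b : a a' / a <= a'}},
            Phi a b @[a --> 0^'+] --> Phi 0 b &
            Phi 0 b = 0] &
      forall a, 0 <= a -> {in `[0, +oo[ &, {homo Phi a : b b' / b <= b'}}].

Definition strict_consistent_error_bound_function (C : 'I_m -> set E)
    (Phi : R -> R -> R) : Prop :=
  consistent_error_bound_function C Phi /\
  forall b, 0 < b -> {in `[0, +oo[ &, {homo Phi ^~ b : a a' / a < a'}}.

Definition error_bound_on (C : 'I_m -> set E) (B : set E) (theta gamma : R) :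
    Prop :=
  forall x, B x ->
    dist x (\bigcap_i C i) <=
      theta * \big[Num.max/0]_(i < m) (dist x (C i) `^ gamma).

Definition holderian_error_bound (C : 'I_m -> set E) : Prop :=
  forall B : set E, bounded_set B ->
    exists theta gamma : R,
      [/\ 0 < theta, 0 < gamma <= 1 & error_bound_on C B theta gamma].

Definition uniform_holderian_error_bound (C : 'I_m -> set E) (gamma : R) :
    Prop :=
  forall B : set E, bounded_set B ->
    exists2 theta : R, 0 < theta & error_bound_on C B theta gamma.

End ErrorBounds.

(* Main.v *)
Require Import Defs.
From mathcomp Require Import all_boot all_order all_algebra.
From mathcomp Require Import all_classical all_reals all_analysis.
Import Order.TTheory GRing.Theory Num.Theory.
Import numFieldNormedType.Exports.
Local Open Scope classical_set_scope.
Local Open Scope ring_scope.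


Set Implicit Arguments.
Unset Strict Implicit.
Unset Printing Implicit Defensive.

(** The theorem is about how the constants of the bound may depend on the
    point [x].

    From error bounds to a bound function, the bound is applied to the balls of
    integer radius, and their constants are collected into step functions of
    [b]: a running maximum of the factors, and a running minimum of the
    exponents. The ball of radius [(truncn `|x|).+1] contains [x], so its
    constants bound the distance from [x], and monotonicity in [b] is built in.
    Lowering an exponent is harmless for residuals [a <= 1] but not for
    [a >= 1]; there [a] itself dominates every [a `^ g] with [g <= 1]. This is
    why the gauge [max (a `^ g) a] appears ([powR_le_gauge]); it also makes the
    gauge nonincreasing in the exponent, which gives monotonicity in [b].

    From a bound function to error bounds, a bounded set [B] lies in a ball of
    radius [M], and monotonicity in [b] allows freezing [b] at [M]. The
    residual is bounded on [B], because distances are at most the distance to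
    one fixed point of the intersection; on a bounded range the gauge is a
    multiple of [a `^ g] ([gauge_le_powR]). *)

(** * The gauge max (a ^ g, a) *)

Section Gauge.
Context {R : realType}.
Implicit Types a g D : R.

Definition gauge g a : R := Num.max (a `^ g) a.

Lemma gauge0 g : 0 < g -> gauge g 0 = 0.
Proof. by move=> g0; rewrite /gauge powR0 ?gt_eqF// maxxx. Qed.

Lemma powR_ltr g : 0 < g ->
  {in `[0, +oo[ &, {homo (fun a : R => a `^ g) : a a' / a < a'}}.
Proof.
move=> g0 a a'; rewrite !in_itv /= !andbT => a0 a'0.
by apply: gt0_ltr_powR; rewrite ?nnegrE.
Qed.

Lemma gauge_ltr g : 0 < g ->
  {in `[0, +oo[ &, {homo gauge g : a a' / a < a'}}.
Proof.
move=> g0 a a' a0 a'0 aa'; rewrite /gauge gt_max !lt_max.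
by rewrite (powR_ltr g0 a0 a'0 aa') aa' orbT.
Qed.

(** Near 0 the gauge is the power: [a <= a `^ g] for [a <= 1]. *)
Lemma gauge_cvg0 g : 0 < g <= 1 -> gauge g a @[a --> 0^'+] --> (0 : R).
Proof.
move=> /andP[g0 g1]; apply: cvg_trans (powR_cvg0 g0).
apply: near_eq_cvg; near=> a.
have a0 : 0 < a by near: a; exact: nbhs_right_gt.
have a1 : a <= 1 by near: a; exact: nbhs_right_le.
by rewrite /gauge max_l// ger1_powR// a0.
Unshelve. all: by end_near. Qed.

(** For [a <= 1] a smaller exponent gives a larger power; for [a >= 1] the
    linear term of the gauge takes over. *)
Lemma powR_le_gauge g g' a : 0 < g' -> g' <= g -> g <= 1 -> 0 <= a ->
  a `^ g <= gauge g' a.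
Proof.
move=> g'0 g'g g1; rewrite le_eqVlt => /predU1P[<-|a0].
  by rewrite gauge0// powR0// gt_eqF// (lt_le_trans g'0).
rewrite /gauge le_max; have [a1|/ltW a1] := leP a 1.
  by rewrite ger_powR// a0.
by rewrite ler1_powR// orbT.
Qed.

Lemma gauge_nincr g g' a : 0 < g' -> g' <= g -> g <= 1 -> 0 <= a ->
  gauge g a <= gauge g' a.
Proof.
move=> g'0 g'g g1 a0; rewrite [leLHS]/gauge ge_max powR_le_gauge//=.
by rewrite /gauge le_max lexx orbT.
Qed.

(** If [a <= 1] then [a <= a `^ g]; if [a >= 1] then [a `^ g >= 1], so that
    [a <= D <= D * a `^ g]. *)
Lemma gauge_le_powR g D a : 0 < g <= 1 -> 1 <= D -> 0 <= a <= D ->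
  gauge g a <= D * a `^ g.
Proof.
move=> /andP[g0 g1] D1 /andP[a0 aD].
have powD : a `^ g <= D * a `^ g by rewrite ler_peMl ?powR_ge0.
rewrite /gauge ge_max powD/=.
move: a0; rewrite le_eqVlt => /predU1P[<-|a0].
  by rewrite powR0 ?gt_eqF// mulr0.
have [a1|/ltW a1] := leP a 1.
  by apply: le_trans powD; rewrite ger1_powR// a0.
apply: (le_trans aD); rewrite ler_peMr ?(le_trans ler01)//.
by rewrite -(powRr0 a) ler_powR// ltW.
Qed.

End Gauge.

(** * Running extrema of constants indexed by the integers *)

Section RunningExtrema.
Context {R : realType}.
Implicit Types (u : nat -> R) (b : R).

(** The index [(truncn b).+1], the radius of a ball containing the points of
    norm [b], is the last one of the range. *)
Definition running_max u b : R := \big[Num.max/1]_(k < (Num.truncn b).+2) u k.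
Definition running_min u b : R := \big[Num.min/1]_(k < (Num.truncn b).+2) u k.

Lemma running_max_gt0 u b : 0 < running_max u b.
Proof. exact: lt_le_trans ltr01 (bigmax_ge_id _ _ _ _). Qed.

Lemma running_max_ge u b : u (Num.truncn b).+1 <= running_max u b.
Proof.
exact: (le_bigmax _ (fun k : 'I__ => u k) (@ord_max (Num.truncn b).+1)).
Qed.

Lemma running_max_homo u : {homo running_max u : b b' / b <= b'}.
Proof.
move=> b b' bb'; apply: (le_bigmax_ord xpredT).
by rewrite !ltnS le_truncn.
Qed.

Lemma running_min_gt0 u b : (forall k, 0 < u k) -> 0 < running_min u b.
Proof. by move=> u0; apply/bigmin_gtP; split. Qed.

Lemma running_min_le1 u b : running_min u b <= 1.
Proof. exact: bigmin_le_id. Qed.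

Lemma running_min_le u b : running_min u b <= u (Num.truncn b).+1.
Proof.
exact: (bigmin_le _ (@ord_max (Num.truncn b).+1) (fun k : 'I__ => u k)).
Qed.

Lemma running_min_nhomo u : {homo running_min u : b b' /~ b <= b'}.
Proof.
move=> b b' bb'; apply: (le_bigmin_ord xpredT).
by rewrite !ltnS le_truncn.
Qed.

End RunningExtrema.

(** * Distances and residuals *)

Section Residuals.
Context {R : realType} {E : normedModType R} {m : nat}.
Implicit Types (x c : E) (C : 'I_m -> set E) (B D : set E).

Lemma dist_ge0 x D : 0 <= dist x D.
Proof.
rewrite /dist; have [->|/set0P[y Dy]] := eqVneq D set0.
  by rewrite image_set0 inf0.
by apply: lb_le_inf => [|_ [z _ <-]//]; exists `|x - y|, y.
Qed.

Lemma dist_le x c D : D c -> dist x D <= `|x - c|.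
Proof.
by move=> Dc; apply: ge_inf; [exists 0 => _ [z _ <-]|exists c].
Qed.

Lemma max_dist_ge0 C x : 0 <= max_dist C x.
Proof. exact: bigmax_ge_id. Qed.

Lemma max_dist_le C x c : (\bigcap_i C i) c -> max_dist C x <= `|x - c|.
Proof. by move=> Cc; apply: bigmax_le => // i _; apply: dist_le; exact: Cc. Qed.

(** Powers with positive exponent are nondecreasing and map 0 to 0, hence
    commute with the maximum. *)
Lemma bigmax_dist_powR C x g : 0 < g ->
  \big[Num.max/0]_(i < m) (dist x (C i) `^ g) = max_dist C x `^ g.
Proof.
move=> g0; rewrite /max_dist.
rewrite (@big_morph_in _ _ (mem Num.nneg) (fun a => a `^ g) 0 Num.max)
  => //.
- by move=> a b; rewrite !nnegrE le_max => ->.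
- by rewrite nnegrE.
- move=> a b a0 b0 /=; have [ab|/ltW ba] := leP a b.
    by rewrite max_r// ge0_ler_powR// ltW.
  by rewrite max_l// ge0_ler_powR// ltW.
- by rewrite powR0// gt_eqF.
- by move=> i _; rewrite nnegrE dist_ge0.
Qed.

Lemma error_bound_onP C B theta g : 0 < g ->
  error_bound_on C B theta g <->
  forall x, B x -> dist x (\bigcap_i C i) <= theta * max_dist C x `^ g.
Proof.
by move=> g0; split=> bnd x /bnd; rewrite bigmax_dist_powR.
Qed.

Lemma bounded_norm_le (r : R) : bounded_set [set x : E | `|x| <= r].
Proof.
rewrite /bounded_set /bounded_near; near=> M => x /= xr.
by apply: (le_trans xr); near: M; apply: nbhs_pinfty_ge; exact: num_real.
Unshelve. all: by end_near. Qed.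

Lemma bounded_set_norm_le B : bounded_set B ->
  exists2 M : R, 0 <= M & forall x, B x -> `|x| <= M.
Proof.
move=> [M [_ bndM]]; exists (Num.max 0 (M + 1)); first by rewrite le_max lexx.
move=> x Bx; apply: (bndM (Num.max 0 (M + 1))) => //.
by rewrite lt_max ltrDl ltr01 orbT.
Qed.

(** A product of a factor depending on [b] and of a profile in [a] inherits
    all structural properties from its two parts; strict monotonicity of the
    profile also yields its nonnegativity and its weak monotonicity. *)
Lemma strict_consistent_scaled C (rho : R -> R) (psi : R -> R -> R) :
  (forall b, 0 <= b -> 0 < rho b) ->
  {in `[0, +oo[ &, {homo rho : b b' / b <= b'}} ->
  (forall b, 0 <= b ->
    [/\ {in `[0, +oo[ &, {homo psi b : a a' / a < a'}},
        psi b a @[a --> 0^'+] --> 0 & psi b 0 = 0]) ->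
  (forall a, 0 <= a -> {in `[0, +oo[ &, {homo psi ^~ a : b b' / b <= b'}}) ->
  (forall x, dist x (\bigcap_i C i) <= rho `|x| * psi `|x| (max_dist C x)) ->
  strict_consistent_error_bound_function C (fun a b => rho b * psi b a).
Proof.
move=> rho0 rho_nd psiP psi_nd bnd.
have incr b : 0 <= b ->
    {in `[0, +oo[ &, {homo (fun a => rho b * psi b a) : a a' / a < a'}}.
  move=> b0 a a' a0 a'0 aa'; have [psi_incr _ _] := psiP b b0.
  by rewrite ltr_pM2l ?rho0// psi_incr.
have nd b : 0 <= b ->
    {in `[0, +oo[ &, {homo (fun a => rho b * psi b a) : a a' / a <= a'}}.
  move=> b0 a a' a0 a'0; rewrite le_eqVlt => /predU1P[->//|aa'].
  by apply/ltW/incr.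
have psi_ge0 a b : 0 <= a -> 0 <= b -> 0 <= psi b a.
  move=> a0 b0; have [psi_incr _ psi0] := psiP b b0.
  move: a0; rewrite le_eqVlt => /predU1P[<-|a0]; first by rewrite psi0.
  by rewrite -psi0 ltW// psi_incr// in_itv/= andbT// ltW.
split; last by move=> b /ltW; exact: incr.
split=> //.
- by move=> a b a0 b0; rewrite mulr_ge0 ?psi_ge0// ltW// rho0.
- move=> b b0; have [_ psi_cvg psi0] := psiP b b0.
  split; [exact: nd| |by rewrite psi0 mulr0].
  by rewrite psi0; apply: cvgMr.
- move=> a a0 b b' b0 b'0 bb'.
  have b0' : 0 <= b by move: b0; rewrite in_itv/= andbT.
  by rewrite ler_pM ?psi_ge0 ?rho_nd ?psi_nd// ltW// rho0.
Qed.

(** The constants of the bound on the ball of radius [(truncn `|x|).+1], which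
    contains [x]. Only the factor is absorbed into a step function, because the
    uniform bound keeps its exponent exactly. *)
Lemma error_bound_on_balls C (theta gamma : nat -> R) :
  (forall n, 0 < gamma n) ->
  (forall n, error_bound_on C [set x | `|x| <= n%:R] (theta n) (gamma n)) ->
  forall x, dist x (\bigcap_i C i) <=
    running_max theta `|x| * max_dist C x `^ gamma (Num.truncn `|x|).+1.
Proof.
move=> gamma0 bnd x; set n := (Num.truncn `|x|).+1.
have /error_bound_onP bndn := bnd n.
apply: (le_trans (bndn (gamma0 n) x _)); first exact/ltW/truncnS_gt.
by rewrite ler_wpM2r ?powR_ge0// running_max_ge.
Qed.

(** Freezing [b] at [M] turns a consistent bound into one that is uniform over
    the ball of radius [M]. *)
Lemma consistent_bound_on_ball C (Phi : R -> R -> R) (M : R) x :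
  consistent_error_bound_function C Phi -> `|x| <= M ->
  dist x (\bigcap_i C i) <= Phi (max_dist C x) M.
Proof.
move=> [_ bnd _ nd] xM; apply: (le_trans (bnd x)).
apply: nd => //; first exact: max_dist_ge0.
  by rewrite in_itv/= normr_ge0.
by rewrite in_itv/= (le_trans _ xM).
Qed.

End Residuals.

(** * The two equivalences *)

Section Equivalences.
Context {R : realType} {E : normedModType R} {m : nat}.
Variable C : 'I_m -> set E.

Lemma holderian_gauge : holderian_error_bound C ->
  exists gamma rho : R -> R,
    [/\ forall b, 0 <= b -> 0 < gamma b <= 1,
        {in `[0, +oo[ &, {homo gamma : b b' /~ b <= b'}},
        forall b, 0 <= b -> 0 < rho b,
        {in `[0, +oo[ &, {homo rho : b b' / b <= b'}} &
        strict_consistent_error_bound_function C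
          (fun a b => rho b * gauge (gamma b) a)].
Proof.
move=> hC.
have /choice[theta /choice[gamma hB]] :=
  fun n : nat => hC _ (bounded_norm_le n%:R).
have gamma0 n : 0 < gamma n by have [_ /andP[]] := hB n.
have gamma1 n : gamma n <= 1 by have [_ /andP[]] := hB n.
have rmin0 b : 0 < running_min gamma b by exact: running_min_gt0.
exists (running_min gamma), (running_max theta); split.
- by move=> b _; rewrite rmin0 running_min_le1.
- by move=> b b' _ _; exact: running_min_nhomo.
- by move=> b _; exact: running_max_gt0.
- by move=> b b' _ _; exact: running_max_homo.
- apply: (@strict_consistent_scaled _ _ _ _ _
    (fun b => gauge (running_min gamma b))).
  + by move=> b _; exact: running_max_gt0.
  + by move=> b b' _ _; exact: running_max_homo.
  + move=> b _; split; [exact: gauge_ltr| |exact: gauge0].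
    by apply: gauge_cvg0; rewrite rmin0 running_min_le1.
  + move=> a a0 b b' _ _ bb'.
    by rewrite gauge_nincr// ?running_min_le1// running_min_nhomo.
  + have bnd n : error_bound_on C [set x | `|x| <= n%:R] (theta n) (gamma n).
      by have [] := hB n.
    move=> x; have := error_bound_on_balls gamma0 bnd x.
    move=> /le_trans; apply.
    rewrite ler_wpM2l ?(ltW (running_max_gt0 _ _))//.
    by rewrite powR_le_gauge ?running_min_le// max_dist_ge0.
Qed.

Lemma gauge_holderian (gamma rho : R -> R) : \bigcap_i C i !=set0 ->
  (forall b, 0 <= b -> 0 < gamma b <= 1) ->
  (forall b, 0 <= b -> 0 < rho b) ->
  consistent_error_bound_function C (fun a b => rho b * gauge (gamma b) a) ->
  holderian_error_bound C.
Proof.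
move=> [c Cc] gammaP rho0 ceb B /bounded_set_norm_le[M M0 BM].
have /andP[g0 g1] := gammaP M M0.
(* On [B] residuals are at most [`|x - c| <= M + `|c|]. *)
pose D := 1 + (M + `|c|).
have D1 : 1 <= D by rewrite lerDl addr_ge0.
exists (rho M * D), (gamma M); split; [|by rewrite g0|].
  by rewrite mulr_gt0 ?rho0// (lt_le_trans ltr01).
apply/error_bound_onP => // x Bx.
apply: (le_trans (consistent_bound_on_ball ceb (BM x Bx))).
rewrite -mulrA ler_wpM2l ?(ltW (rho0 M M0))//.
apply: gauge_le_powR; rewrite ?g0// max_dist_ge0/=.
apply: (le_trans (max_dist_le x Cc)); apply: (le_trans (ler_normB _ _)).
by rewrite -[leLHS]add0r lerD// lerD// BM.
Qed.

Lemma uniform_holderian_powR (g : R) : 0 < g ->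
  uniform_holderian_error_bound C g <->
  exists rho : R -> R,
    [/\ forall b, 0 <= b -> 0 < rho b,
        {in `[0, +oo[ &, {homo rho : b b' / b <= b'}} &
        strict_consistent_error_bound_function C (fun a b => rho b * a `^ g)].
Proof.
move=> g0; split=> [hC|[rho [rho0 _ [ceb _]]] B /bounded_set_norm_le[M M0 BM]].
  have /choice[theta hB] : forall n : nat, exists t : R,
      error_bound_on C [set x | `|x| <= n%:R] t g.
    by move=> n; have [t _ ht] := hC _ (bounded_norm_le n%:R); exists t.
  exists (running_max theta); split.
  - by move=> b _; exact: running_max_gt0.
  - by move=> b b' _ _; exact: running_max_homo.
  - apply: (strict_consistent_scaled (psi := fun _ a => a `^ g)).
    + by move=> b _; exact: running_max_gt0.
    + by move=> b b' _ _; exact: running_max_homo.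
    + move=> b _; split; [exact: powR_ltr|exact: powR_cvg0|].
      by rewrite powR0// gt_eqF.
    + by move=> a _ b b' _ _ _ /=.
    + exact: (@error_bound_on_balls _ _ _ C theta (fun=> g)).
exists (rho M); first exact: rho0.
apply/error_bound_onP => // x Bx.
exact: consistent_bound_on_ball ceb (BM x Bx).
Qed.

End Equivalences.

Theorem theorem3p5 (R : realType) (E : normedVectType R)
    (ip : {dot E for (@idfun R)})
    (norm_ip : forall x : E, `|x| = Num.sqrt (ip x x))
    (m : nat) (m_gt0 : (0 < m)%N) (C : 'I_m -> set E)
    (C_closed : forall i, closed (C i))
    (C_convex : forall i, convex_set (C i))
    (C_neq0 : \bigcap_i C i !=set0) :
  (holderian_error_bound C <->
    exists gamma rho : R -> R,
      [/\ forall b, 0 <= b -> 0 < gamma b <= 1,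
          {in `[0, +oo[ &, {homo gamma : b b' /~ b <= b'}},
          forall b, 0 <= b -> 0 < rho b,
          {in `[0, +oo[ &, {homo rho : b b' / b <= b'}} &
          strict_consistent_error_bound_function C
            (fun a b => rho b * Num.max (a `^ gamma b) a)]) /\
  (forall g : R, 0 < g <= 1 ->
    (uniform_holderian_error_bound C g <->
      exists rho : R -> R,
        [/\ forall b, 0 <= b -> 0 < rho b,
            {in `[0, +oo[ &, {homo rho : b b' / b <= b'}} &
            strict_consistent_error_bound_function C
              (fun a b => rho b * a `^ g)])).
Proof.
split.
  split; first exact: holderian_gauge.
  by move=> [gamma [rho [gammaP _ rho0 _ [ceb _]]]]; exact: gauge_holderian ceb.
by move=> g /andP[g0 _]; exact: uniform_holderian_powR.
Qed.
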